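(* Consider the total-energy platooning problem with an arbitrary number $n$ of vehicles and an arbitrary number $m$ of road segments, in which $S_{j1}C_j\ge\bar L$ for all $j$, where $\bar L$ is sufficiently large that every solution is feasible. Rule 4 solves this problem (i.e. yields a solution minimizing $\sum_{j=1}^n\delta_j\sum_{i=1}^mD_i(1-\eta_{j_i})$) in $O(n\log n)$ time.
   Context: Setting. There are $n$ vehicles and $m$ road segments with lengths $D_1,\ldots,D_m>0$. Vehicle $j$ has battery capacity $C_j>0$, usage rate $\delta_j>0$, initial state of charge $S_{j1}\in[0,1]$, and minimum allowable state of charge $\beta_j$ with $0\le\beta_j<S_{j1}$. Platoon positions have usage-rate reductions $0\le\eta_1\le\cdots\le\eta_n<1$. A solution specifies for each segment $i$ a permutation of the positions; $j_i$ is the position of vehicle $j$ in segment $i$. The total energy usage of vehicle $j$ is $U_j=\delta_j\sum_{i=1}^mD_i(1-\eta_{j_i})$, and a solution is feasible if $S_{j1}-U_j/C_j\ge\beta_j$ for all $j$. The problem is to minimize $\sum_jU_j$ over feasible solutions. The condition $S_{j1}C_j\ge\bar L$ means that initial energy levels are large enough that any solution is feasible, e.g. $\bar L\ge\beta_jC_j+\sum_{i=1}^mD_i(1-\eta_1)\delta_j$ for $j=1,\ldots,n$. Rule 4: Reindex the vehicles in non-decreasing order of $\delta_j$, and assign vehicle $j$ to the $j$th position in every road segment, for $j=1,\ldots,n$. Running time counts elementary arithmetic operations and comparisons; the output is the single position sequence used in every segment. *)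

(* Defs.v *)
From HB Require Import structures.
From mathcomp Require Import all_boot all_order all_algebra all_fingroup.
From mathcomp Require Import all_classical all_reals all_analysis.

Set Implicit Arguments.
Unset Strict Implicit.
Unset Printing Implicit Defensive.

Import Order.TTheory GRing.Theory Num.Theory.

Local Open Scope ring_scope.

(* MathComp-Analysis. Vehicles, segments and positions are numbered from 0. *)

Record platooning (R : realType) (n m : nat) := Platooning {
  seg_length : 'I_m -> R;
  capacity : 'I_n -> R;
  usage_rate : 'I_n -> R;
  init_charge : 'I_n -> R;
  min_charge : 'I_n -> R;
  reduction : 'I_n -> R;  (* indexed by positions, not by vehicles *)
  seg_length_gt0 : forall i, 0 < seg_length i;
  capacity_gt0 : forall j, 0 < capacity j;
  usage_rate_gt0 : forall j, 0 < usage_rate j;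
  init_charge_itv : forall j, 0 <= init_charge j <= 1;
  min_charge_itv : forall j, 0 <= min_charge j < init_charge j;
  reduction_itv : forall k, 0 <= reduction k < 1;
  reduction_mono : forall k l : 'I_n, (k <= l)%N -> reduction k <= reduction l
}.

(* [x i j] is the position of vehicle [j] in segment [i]. *)
Definition solution (n m : nat) := 'I_m -> 'S_n.

Section Problem.
Variables (R : realType) (n m : nat) (P : platooning R n m).
Implicit Types x y : solution n m.

Definition energy_usage x (j : 'I_n) : R :=
  usage_rate P j * \sum_(i < m) seg_length P i * (1 - reduction P (x i j)).

Definition total_energy x : R := \sum_(j < n) energy_usage x j.

Definition feasible x : Prop :=
  forall j, min_charge P j <= init_charge P j - energy_usage x j / capacity P j.

Definition optimal x : Prop :=
  feasible x /\ forall y, feasible y -> total_energy x <= total_energy y.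

Definition initial_energy_ge (L : R) : Prop :=
  forall j, L <= init_charge P j * capacity P j.

Definition sufficiently_large (L : R) : Prop :=
  initial_energy_ge L -> forall x, feasible x.

(* [sigma k] is the vehicle whose new index is [k]. Ties between equal usage
   rates may be broken in any way. *)
Definition rule4_reindexing (sigma : 'S_n) : Prop :=
  forall k l : 'I_n, (k <= l)%N ->
    usage_rate P (sigma k) <= usage_rate P (sigma l).

Definition rule4_solution (sigma : 'S_n) : solution n m := fun=> (sigma^-1)%g.

End Problem.

Record timed (A : Type) := Timed { value : A; time : nat }.

Definition ret A (a : A) : timed A := Timed a 0.

Definition bind A B (u : timed A) (f : A -> timed B) : timed B :=
  let v := f (value u) in Timed (value v) (time u + time v).

Definition tick A (u : timed A) : timed A := Timed (value u) (time u).+1.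

Notation "'let*' x := u 'in' v" := (bind u (fun x => v))
  (at level 200, x name, u at level 100, v at level 200).

(* Merge sort, following [path.sort] step by step. The keys are accessed only
   through [cmp], which is charged below. Besides the calls to [cmp], every
   (recursive) call costs one unit, which accounts for the emptiness tests and
   the list cells it handles, so that no unbounded amount of work is free. *)
Section TimedSort.
Variables (T : Type) (cmp : T -> T -> timed bool).

Fixpoint timed_merge (s1 : seq T) : seq T -> timed (seq T) :=
  if s1 is x1 :: s1' then
    let fix merge_s1 s2 :=
      if s2 is x2 :: s2' then
        tick (let* b := cmp x1 x2 in
              if b then let* s := timed_merge s1' s2 in ret (x1 :: s)
              else let* s := merge_s1 s2' in ret (x2 :: s))
      else tick (ret s1) in
    merge_s1
  else fun s2 => tick (ret s2).

Fixpoint timed_push (s1 : seq T) (ss : seq (seq T)) : timed (seq (seq T)) :=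
  match ss with
  | [::] :: ss' | [::] as ss' => tick (ret (s1 :: ss'))
  | s2 :: ss' =>
      tick (let* s := timed_merge s2 s1 in
            let* ss1 := timed_push s ss' in
            ret ([::] :: ss1))
  end.

Fixpoint timed_pop (s1 : seq T) (ss : seq (seq T)) : timed (seq T) :=
  if ss is s2 :: ss' then
    tick (let* s := timed_merge s2 s1 in timed_pop s ss')
  else tick (ret s1).

Fixpoint timed_sort_rec (ss : seq (seq T)) (s : seq T) : timed (seq T) :=
  if s is [:: x1, x2 & s'] then
    tick (let* b := cmp x1 x2 in
          let* ss1 := timed_push (if b then [:: x1; x2] else [:: x2; x1]) ss in
          timed_sort_rec ss1 s')
  else tick (timed_pop s ss).

Definition timed_sort (s : seq T) : timed (seq T) := timed_sort_rec [::] s.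

End TimedSort.

(* The output lists the vehicles by position; it is used in every segment. *)
Definition rule4 (R : realType) (n m : nat) (P : platooning R n m) :
    timed (seq 'I_n) :=
  timed_sort
    (fun j1 j2 => tick (ret (usage_rate P j1 <= usage_rate P j2)))
    (enum 'I_n).

(* Main.v *)
(* In a fixed segment the usage is [sum_j delta_j - sum_j delta_j eta_(x j)], so
   optimality is the rearrangement inequality: writing the nondecreasing [eta]
   as a combination, with nonnegative coefficients from the second one on, of
   the threshold functions [k |-> (l <= k)], it suffices to treat thresholds.
   For the running time, the stack of merge sort is a binary counter, hence has
   at most [log_2 n] levels, and each element is merged upwards at most once per
   level. *)
Require Import Defs.
From HB Require Import structures.
From mathcomp Require Import all_boot all_order all_algebra all_fingroup.
From mathcomp Require Import all_classical all_reals all_analysis.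
From mathcomp Require Import zify.
Set Implicit Arguments.
Unset Strict Implicit.
Unset Printing Implicit Defensive.
Import Order.TTheory GRing.Theory Num.Theory.
Local Open Scope classical_set_scope.
Local Open Scope ring_scope.

(** * The rearrangement inequality *)

Section Rearrangement.
Variable R : realDomainType.

(* The threshold functions sum to the same value over any permutation, so [a k]
   may be replaced by [a k - a l], which makes every summand nonnegative. *)
Lemma rearrangement_threshold n (a : 'I_n -> R) (t : 'S_n) (l : 'I_n) :
    {homo a : i j / (i <= j)%N >-> i <= j} ->
  \sum_(k < n) a k * (l <= t k)%N%:R <= \sum_(k < n) a k * (l <= k)%N%:R.
Proof.
move=> a_mono; rewrite -subr_ge0 -sumrB.
have sum0 : \sum_(k < n) ((l <= k)%N%:R - (l <= t k)%N%:R) = 0 :> R.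
  by rewrite sumrB [X in _ - X](reindex_inj (@perm_inj _ t^-1)) /=;
     under [X in _ - X]eq_bigr do rewrite permKV; rewrite subrr.
have -> : \sum_(k < n) (a k * (l <= k)%N%:R - a k * (l <= t k)%N%:R) =
    \sum_(k < n) (a k - a l) * ((l <= k)%N%:R - (l <= t k)%N%:R).
  under [RHS]eq_bigr do rewrite mulrBl.
  rewrite [RHS]sumrB -mulr_sumr sum0 mulr0 subr0.
  by apply: eq_bigr => k _; rewrite mulrBr.
apply: sumr_ge0 => k _; case: (leqP l k) => [lk | /ltnW kl].
  by rewrite mulr_ge0 // ?subr_ge0 ?a_mono // lern1 leq_b1.
by rewrite mulr_le0 // ?sub0r ?oppr_le0 ?ler0n // subr_le0 a_mono.
Qed.

Lemma rearrangement n (a b : 'I_n -> R) (t : 'S_n) :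
    {homo a : i j / (i <= j)%N >-> i <= j} ->
    {homo b : i j / (i <= j)%N >-> i <= j} ->
  \sum_(k < n) a k * b (t k) <= \sum_(k < n) a k * b k.
Proof.
case: n => [|n] in a b t * => a_mono b_mono; first by rewrite !big_ord0.
pose b' i := b (inord i); pose d i := if i is j.+1 then b' i - b' j else b' 0%N.
have layers k : b k = \sum_(l < n.+1) d l * (l <= k)%N%:R.
  have -> : b k = \sum_(0 <= l < k.+1) d l.
    rewrite big_nat_recl //= telescope_sumr // addrC subrK.
    by rewrite /b' inord_val.
  rewrite -(big_mkord xpredT (fun l => d l * (l <= k)%N%:R)).
  rewrite [RHS](big_cat_nat _ (ltn_ord k)) //=.
  rewrite [X in _ + X]big_nat_cond [X in _ + X]big1 ?addr0;
    last move=> l /andP[/andP[kl _] _].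
    by apply: eq_big_nat => l /andP[_ lk]; rewrite -ltnS lk mulr1.
  by rewrite leqNgt kl mulr0.
have swap f : \sum_(k < n.+1) a k * b (f k) =
    \sum_(l < n.+1) d l * \sum_(k < n.+1) a k * (l <= f k)%N%:R.
  under eq_bigr do rewrite layers mulr_sumr.
  rewrite exchange_big; apply: eq_bigr => l _; rewrite mulr_sumr.
  by apply: eq_bigr => k _; rewrite mulrCA.
(* The layer [l = 0] is equal on both sides, its threshold being constantly 1, so [d 0] may have any
   sign; every later [d l] is an increment of [b]. *)
rewrite (swap t) (swap id) !big_ord_recl lerD //.
apply: ler_sum => l _; apply: ler_wpM2l; last exact: rearrangement_threshold.
rewrite /= subr_ge0 b_mono // !inordK // /bump /=; have := ltn_ord l; lia.
Qed.

End Rearrangement.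

(** * Optimality of Rule 4 *)

Section Optimality.
Variables (R : realType) (n m : nat) (P : platooning R n m).

(** Only the savings depend on [x]; summing them along [sigma] gives them the shape treated in
    [rearrangement]. *)
Lemma total_energyE (x : solution n m) (sigma : 'S_n) :
  total_energy P x = \sum_(i < m) seg_length P i *
    (\sum_j usage_rate P j -
     \sum_(k < n) usage_rate P (sigma k) * reduction P (x i (sigma k))).
Proof.
rewrite /total_energy /energy_usage.
under eq_bigr do rewrite mulr_sumr.
rewrite exchange_big; apply: eq_bigr => i _.
have <- : \sum_j usage_rate P j * reduction P (x i j) =
    \sum_k usage_rate P (sigma k) * reduction P (x i (sigma k)).
  by rewrite (reindex_inj (@perm_inj _ sigma)).
rewrite -sumrB mulr_sumr.
by apply: eq_bigr => j _; rewrite mulrCA mulrBr mulr1.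
Qed.

Lemma rule4_total_energy_le (sigma : 'S_n) (x : solution n m) :
  rule4_reindexing P sigma ->
  total_energy P (@rule4_solution n m sigma) <= total_energy P x.
Proof.
move=> sorted_sigma; rewrite !(total_energyE _ sigma).
apply: ler_sum => i _; apply: ler_wpM2l; first exact/ltW/seg_length_gt0.
rewrite lerD2l lerN2.
(* Products of permutations act from left to right: [sigma * x i] sends [k] to [x i (sigma k)]. For
   the Rule 4 solution it is the identity. *)
have := @rearrangement R n (usage_rate P \o sigma) (reduction P)
  (sigma * x i)%g sorted_sigma (@reduction_mono _ _ _ P).
under eq_bigr do rewrite permM; move/le_trans; apply.
by rewrite le_eqVlt; apply/predU1l/eq_bigr => k _; rewrite permK.
Qed.

End Optimality.

(** * The running time of merge sort *)

(** For each level of the stack, [2 * n + 2] pays for the final merges and [4 * n] for the potential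
    built up by the pushes. The term [2 * n] grants four units to each pair read, and the last [2]
    covers the two closing calls. *)
Definition sort_bound n : nat :=
  (2 * n + (6 * n + 2) * trunc_log 2 n + 2)%N.

Section SortTime.
Local Open Scope nat_scope.
Variables (T : Type) (leT : rel T).
Implicit Types (s : seq T) (ss : seq (seq T)).

Let cmp x y := tick (ret (leT x y)).

Lemma value_timed_merge s1 s2 : value (timed_merge cmp s1 s2) = merge leT s1 s2.
Proof.
elim: s1 s2 => [|x1 s1 IH1] s2 //; elim: s2 => [|x2 s2 IH2] //=.
by case: (leT x1 x2) => /=; congr cons; [exact: IH1 | exact: IH2].
Qed.

Lemma time_timed_merge s1 s2 :
  time (timed_merge cmp s1 s2) <= 2 * (size s1 + size s2) + 1.
Proof.
elim: s1 s2 => [|x1 s1 IH1] s2; first by rewrite /=; lia.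
elim: s2 => [|x2 s2 IH2] //=.
case: (leT x1 x2) => /=; last by move: IH2; rewrite /=; lia.
by have := IH1 (x2 :: s2); rewrite /=; lia.
Qed.

Lemma value_timed_push s1 ss :
  value (timed_push cmp s1 ss) = path.merge_sort_push leT s1 ss.
Proof.
elim: ss s1 => [|[|x s2] ss IH] s1 //.
transitivity ([::] :: value (timed_push cmp
  (value (timed_merge cmp (x :: s2) s1)) ss)) => //.
by rewrite IH value_timed_merge.
Qed.

Lemma value_timed_pop s1 ss :
  value (timed_pop cmp s1 ss) = path.merge_sort_pop leT s1 ss.
Proof. by elim: ss s1 => [|s2 ss IH] s1 //=; rewrite IH value_timed_merge. Qed.

Lemma value_timed_sort s : value (timed_sort cmp s) = sort leT s.
Proof.
rewrite /timed_sort /sort; move: {2}(size s) (leqnn (size s)) [::] => k.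
elim: k s => [|k IH] [|x [|y s]] //= sk ss; rewrite ?value_timed_pop //.
rewrite IH ?value_timed_push //; lia.
Qed.

Definition total_size ss := sumn (map size ss).

Lemma total_size_push s1 ss :
  total_size (path.merge_sort_push leT s1 ss) = size s1 + total_size ss.
Proof.
rewrite /total_size; elim: ss s1 => [|[|x s2] ss IH] s1 //.
rewrite [path.merge_sort_push _ _ _]/= [LHS]/= add0n IH size_merge size_cat /=.
lia.
Qed.

Lemma time_timed_pop s1 ss :
  time (timed_pop cmp s1 ss) <=
    (2 * (size s1 + total_size ss) + 2) * size ss + 1.
Proof.
rewrite /total_size; elim: ss s1 => [|s2 ss IH] s1 /=; first by lia.
have := IH (merge leT s2 s1); rewrite value_timed_merge size_merge size_cat.
have := time_timed_merge s2 s1; nia.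
Qed.

(* Each element of the stack has paid 4 units for every level below its own.
   Merging [t] elements in all costs at most [2 * t + 1], plus 1 for the
   enclosing push, and [2 * t + 2 <= 4 * t]. *)
Fixpoint potential k ss :=
  if ss is s :: ss' then 4 * k * size s + potential k.+1 ss' else 0.

Lemma potential_le k ss : potential k ss <= 4 * (k + size ss) * total_size ss.
Proof.
rewrite /total_size; elim: ss k => [|s ss IH] k //=.
by have := IH k.+1; nia.
Qed.

(** A merge lifts its elements by one level, hence the induction hypothesis at [k.+1]; the unit on
    the right pays for placing the run in a free slot. *)
Lemma time_timed_push k s1 ss :
  time (timed_push cmp s1 ss) + 4 * k * size s1 + potential k ss <=
    potential k (path.merge_sort_push leT s1 ss) + 1.
Proof.
elim: ss k s1 => [|[|x s2] ss IH] k s1; [rewrite /=; lia | rewrite /=; lia |].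
pose u := timed_merge cmp (x :: s2) s1.
have IHu := IH k.+1 (value u).
have := time_timed_merge (x :: s2) s1; rewrite -/u.
have : size (value u) = (size s2).+1 + size s1.
  by rewrite /u value_timed_merge size_merge size_cat.
rewrite [timed_push _ _ _](_ : _ = tick (bind u (fun s =>
  bind (timed_push cmp s ss) (fun ss1 => ret ([::] :: ss1))))) //.
rewrite [path.merge_sort_push _ _ _](_ : _ = [::] ::
  path.merge_sort_push leT (value u) ss); last by rewrite /u value_timed_merge.
by move: IHu; rewrite /=; nia.
Qed.

(* In [binary_stack i ss] the index [i] is the level of the head of [ss]; [sort]
   pushes pairs, so its stack starts at level 1. *)
Fixpoint binary_stack i ss :=
  if ss is s :: ss' then
    [&& nilp s || (size s == 2 ^ i), binary_stack i.+1 ss'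
      & nilp ss' ==> ~~ nilp s]
  else true.

(** This is the carry of a binary counter: two runs of size [2 ^ i] merge into one of size
    [2 ^ i.+1], passed on to the next slot. *)
Lemma binary_stack_push i s1 ss :
    size s1 = 2 ^ i -> binary_stack i ss ->
  binary_stack i (path.merge_sort_push leT s1 ss).
Proof.
elim: ss i s1 => [|[|x s2] ss IH] i s1 s1i.
- by rewrite /= s1i eqxx orbT /nilp s1i -lt0n expn_gt0.
- rewrite /= s1i eqxx orbT /= => /andP[-> _].
  by rewrite /nilp s1i -lt0n expn_gt0 implybT.
move=> /= /and3P[/eqP s2i ssi _].
rewrite IH //; last by rewrite size_merge size_cat /= s2i s1i expnS; lia.
by case: ss {IH ssi} => [|[|? ?] ?].
Qed.

(** The last slot is nonempty, so it alone holds half of the left-hand side. *)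
Lemma binary_stack_size i ss :
    binary_stack i ss -> 0 < size ss ->
  2 ^ (i + size ss) <= 2 * total_size ss.
Proof.
rewrite /total_size; elim: ss i => [|s [|s' ss] IH] i //=.
  by case: s => [|x s] //= /andP[/eqP -> _] _; rewrite addn1 expnS; lia.
move=> /andP[_ /andP[ssi _]] _; have := IH i.+1 ssi isT.
by rewrite /= -!addSnnS; lia.
Qed.

Lemma time_timed_pop_potential s ss :
  let N := size s + total_size ss in
  binary_stack 1 ss ->
  time (timed_pop cmp s ss) + potential 0 ss <= (6 * N + 2) * trunc_log 2 N + 1.
Proof.
(* Since the stack starts at level 1, the factors 2 cancel and leave [2 ^ size ss <= N]. *)
move=> N ss1; have levels : size ss <= trunc_log 2 N.
  case: (posnP (size ss)) => [-> // | ss_gt0]; apply: trunc_log_max => //.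
  by have := binary_stack_size ss1 ss_gt0; rewrite expnD expn1 /N; lia.
have := time_timed_pop s ss; have := potential_le 0 ss.
rewrite -/N add0n; have : total_size ss <= N by rewrite leq_addl.
move: (trunc_log 2 N) (potential 0 ss) (time _) levels; nia.
Qed.

Lemma time_timed_sort s : time (timed_sort cmp s) <= sort_bound (size s).
Proof.
rewrite /sort_bound.
(* [N] counts pending and stacked elements together, so it is invariant; the potential on the left
   stands for the pushes already made. *)
suff rec ss : let N := size s + total_size ss in binary_stack 1 ss ->
    time (timed_sort_rec cmp ss s) + potential 0 ss <=
      2 * size s + (6 * N + 2) * trunc_log 2 N + 2.
  by have := rec [::] isT; rewrite /= !addn0.
have [k] := ubnP (size s); elim: k s ss => // k IH s ss sk N ss1.
have [s_lt2 | s_ge2] := ltnP (size s) 2.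
  have -> : timed_sort_rec cmp ss s = tick (timed_pop cmp s ss).
    by case: s {sk N} s_lt2 => [|x [|y s]].
  by have := time_timed_pop_potential s ss1; rewrite -/N /=; lia.
case: s => [|x [|y s]] // in sk N s_ge2 *.
set s1 := if leT x y then [:: x; y] else [:: y; x].
pose ss' := path.merge_sort_push leT s1 ss.
have -> : timed_sort_rec cmp ss [:: x, y & s] =
    tick (bind (cmp x y) (fun=> bind (timed_push cmp s1 ss)
      (fun ss1 => timed_sort_rec cmp ss1 s))) by [].
have s1E : size s1 = 2 ^ 1 by rewrite /s1; case: ifP.
rewrite /= value_timed_push -/ss'.
have := IH s ss' _ (binary_stack_push s1E ss1).
have := time_timed_push 0 s1 ss; rewrite total_size_push s1E expn1 -/ss'.
have -> : size s + (2 + total_size ss) = N by rewrite /N /=; lia.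
rewrite /= in sk *; lia.
Qed.

End SortTime.

(** * Output and cost of Rule 4 *)

Section Rule4.
Variables (R : realType) (n m : nat) (P : platooning R n m).

Lemma rule4_sort :
  value (rule4 P) =
  sort (fun i j => usage_rate P i <= usage_rate P j) (enum 'I_n).
Proof. exact: value_timed_sort. Qed.

Lemma rule4_time : (time (rule4 P) <= sort_bound n)%N.
Proof.
have := time_timed_sort (fun i j => usage_rate P i <= usage_rate P j)
  (enum 'I_n).
by rewrite size_enum_ord.
Qed.

(** The output has [n] distinct entries, so taking its [k]-th entry is an injective self-map of a
    finite type, hence a permutation. *)
Lemma rule4_reindexing_ex :
  exists2 sigma : 'S_n, rule4_reindexing P sigma &
    value (rule4 P) = [seq sigma k | k <- enum 'I_n].
Proof.
set s := value (rule4 P).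
have s_size : size s == n by rewrite /s rule4_sort size_sort size_enum_ord.
have s_uniq : uniq s by rewrite /s rule4_sort sort_uniq enum_uniq.
pose f := tnth (Tuple s_size).
have f_inj : injective f by apply/tuple_uniqP.
exists (perm f_inj) => [k l kl|].
  have x0 := k; rewrite !permE /f !(tnth_nth x0) /=.
  apply: (sorted_leq_nth (leT := fun i j => usage_rate P i <= usage_rate P j)).
  - by move=> y x z; exact: le_trans.
  - by move=> x; exact: lexx.
  - by rewrite /s rule4_sort; apply: sort_sorted => x y; exact: le_total.
  - by rewrite inE (eqP s_size).
  - by rewrite inE (eqP s_size).
  - exact: kl.
under eq_map do rewrite permE.
by rewrite map_tnth_enum.
Qed.

End Rule4.

(** * Asymptotics and conclusion *)

Lemma sort_bound_bigO (R : realType) :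
  (fun n => (sort_bound n)%:R : R) =O_\oo
  (fun n => n%:R * ln (n%:R : R)).
Proof.
have ln2_gt0 : 0 < ln (2 : R) by rewrite ln_gt0 // ltr1n.
(* Here 10 is 2 + 6 + 2, and [ln 2] converts from base 2. At [n = 1] the comparison function
   vanishes but the bound is 4, so the estimate starts at 2. *)
apply/eqO_exP; exists (10 / ln 2); first by rewrite divr_gt0.
exists 2%N => //= n /= n_ge2.
have L_ge1 : (1 <= trunc_log 2 n)%N by apply: trunc_log_max.
have ln_le : (trunc_log 2 n)%:R * ln 2 <= ln (n%:R : R).
  rewrite -[leLHS]mulrC mulr_natr -lnXn // -natrX.
  rewrite ler_ln ?posrE ?ltr0n ?expn_gt0 //; last lia.
  by rewrite ler_nat trunc_logP //; lia.
rewrite ger0_norm ?ler0n // ger0_norm; last first.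
  by rewrite mulr_ge0 ?ler0n // (le_trans _ ln_le) // mulr_ge0 ?ler0n ?ltW.
apply: (@le_trans _ _ (10 * n * trunc_log 2 n)%:R).
  by rewrite ler_nat /sort_bound; nia.
rewrite !natrM -!mulrA ler_pM2l // mulrCA ler_wpM2l ?ler0n //.
by rewrite mulrC ler_pdivlMr.
Qed.

Theorem proposition11 (R : realType) :
  exists2 T : nat -> R, T =O_\oo (fun n : nat => n%:R * ln (n%:R : R)) &
  forall (n m : nat) (P : platooning R n m) (L : R),
    initial_energy_ge P L -> sufficiently_large P L ->
    (forall sigma : 'S_n,
       rule4_reindexing P sigma -> optimal P (rule4_solution sigma)) /\
    (exists sigma : 'S_n,
       [/\ rule4_reindexing P sigma,
           value (rule4 P) = [seq sigma k | k <- enum 'I_n] &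
           (time (rule4 P))%:R <= T n]).
Proof.
exists (fun n => (sort_bound n)%:R); first exact: sort_bound_bigO.
move=> n m P L init large; split=> [sigma sorted_sigma|].
  split=> [|x _]; first exact: large.
  exact: rule4_total_energy_le.
have [sigma sorted_sigma valueE] := rule4_reindexing_ex P.
by exists sigma; split=> //; rewrite ler_nat rule4_time.
Qed.
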